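(* Let $n\ge 2$ be even, let $S\subseteq D_n$ be non-empty with $1\notin S$ and $S=S^{-1}$, and let $A$ be the adjacency matrix of $\mathrm{Cay}(D_n,S)$. The eigenvalues and corresponding normalized eigenvectors of $A$ associated with the one-dimensional representations of $D_n$ are as follows. (i) For the character $\psi_1$, the eigenvalue and a corresponding eigenvector are $\widetilde{\lambda}_1=d$ and $v_1=\frac{1}{\sqrt{2n}}\mathbf{1}_{2n}^{t}$. (ii) For the character $\psi_2$, they are $\widetilde{\lambda}_2=s_1-s_2$ and $v_2=\frac{1}{\sqrt{2n}}(\mathbf{1}_n,-\mathbf{1}_n)^{t}$. (iii) For the character $\psi_3$, they are $\widetilde{\lambda}_3=d_{1,0}-d_{1,1}+d_{2,0}-d_{2,1}$ and $v_3=\frac{1}{\sqrt{2n}}\left(\{(-1)^i\}_{i=0}^{n-1},\{(-1)^i\}_{i=0}^{n-1}\right)^{t}$. (iv) For the character $\psi_4$, they are $\widetilde{\lambda}_4=d_{1,0}-d_{1,1}+d_{2,1}-d_{2,0}$ and $v_4=\frac{1}{\sqrt{2n}}\left(\{(-1)^i\}_{i=0}^{n-1},\{(-1)^{i+1}\}_{i=0}^{n-1}\right)^{t}$.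
   Context: $D_n=\langle a,b: a^n=1=b^2,\ bab=a^{-1}\rangle$ is the dihedral group of order $2n$. For a finite group $\Gamma$ and non-empty $S\subseteq\Gamma$ with $1\notin S=S^{-1}$, the Cayley graph $\mathrm{Cay}(\Gamma,S)$ has vertex set $\Gamma$ and edges $\{u,v\}$ with $uv^{-1}\in S$. Rows and columns of $A$ and entries of vectors are ordered as $1,a,\ldots,a^{n-1},b,ba,\ldots,ba^{n-1}$. For $n$ even, the one-dimensional representations of $D_n$ are, for $0\le k\le n-1$: $\psi_1(a^k)=\psi_1(ba^k)=1$; $\psi_2(a^k)=1$, $\psi_2(ba^k)=-1$; $\psi_3(a^k)=\psi_3(ba^k)=(-1)^k$; $\psi_4(a^k)=(-1)^k$, $\psi_4(ba^k)=(-1)^{k+1}$. For an irreducible unitary representation $\rho$ of $D_n$, let $V_\rho\subseteq\mathbb{C}^{D_n}$ be the span of the matrix coefficients of $\rho$; it is $A$-invariant, and an eigenvalue/eigenvector of $A$ is associated with $\rho$ if it is an eigenvalue/eigenvector of the restriction of $A$ to $V_\rho$. $S_1=S\cap\langle a\rangle$, $S_2=bS\cap\langle a\rangle$ with $bS=\{bs:s\in S\}$. For $i\in\{1,2\}$, $S_{i,0}=\{a^k\in S_i:0\le k\le n-1,\ k\text{ even}\}$ and $S_{i,1}=\{a^k\in S_i:0\le k\le n-1,\ k\text{ odd}\}$; $s_i=|S_i|$, $d_{i,0}=|S_{i,0}|$, $d_{i,1}=|S_{i,1}|$, $d=|S|$. $\mathbf{1}_r$ is the all-ones row vector of length $r$,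 and $\{z_i\}_{i=0}^{n-1}$ denotes the row vector $(z_0,\ldots,z_{n-1})$. *)

(* Defs.v *)
From mathcomp Require Import all_boot all_order all_algebra.
From mathcomp Require Import all_fingroup all_solvable mxrepresentation.
From mathcomp Require Import complex reals.
Set Implicit Arguments.
Unset Strict Implicit.
Unset Printing Implicit Defensive.
Import Order.TTheory GRing.Theory Num.Theory.
Local Open Scope ring_scope.

(* [gT] is intended to be the dihedral group ['D_(2 * n)] of order 2n; there,
   generators satisfying the defining relations give a surjective, hence
   bijective, homomorphism from the presented group onto it, so (a, b) is a
   pair of generators as in the presentation. *)
Definition dihedral_generators (gT : finGroupType) (n : nat) (a b : gT) : Prop :=
  [/\ (a ^+ n = 1)%g, (b ^+ 2 = 1)%g, (b * a * b = a^-1)%g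
    & <<[set a; b]>>%g = [set: gT]].

(* The ordering 1, a, ..., a^(n-1), b, ba, ..., ba^(n-1). *)
Definition dihedral_elt (gT : finGroupType) (n : nat) (a b : gT)
    (x : 'I_(n + n)) : gT :=
  match split x with
  | inl k => (a ^+ k)%g
  | inr k => (b * a ^+ k)%g
  end.

Definition cayley_edge (gT : finGroupType) (S : {set gT}) : rel gT :=
  fun u v => (u * v^-1)%g \in S.

Definition cayley_adjmx (K : pzRingType) (gT : finGroupType) (n : nat)
    (a b : gT) (S : {set gT}) : 'M[K]_(n + n) :=
  \matrix_(x, y) (cayley_edge S (dihedral_elt a b x) (dihedral_elt a b y))%:R.

Definition rot_part (gT : finGroupType) (a : gT) (S : {set gT}) : {set gT} :=
  S :&: <[a]>%g.

Definition refl_part (gT : finGroupType) (a b : gT) (S : {set gT}) : {set gT} :=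
  (b *: S)%g :&: <[a]>%g.

Definition parity_part (gT : finGroupType) (n : nat) (a : gT) (p : bool)
    (T : {set gT}) : {set gT} :=
  [set g in T | [exists k : 'I_n, (g == (a ^+ k)%g) && (odd k == p)]].

(* The span of the matrix coefficients of [rho], inside the column vectors
   indexed by the group through [dihedral_elt]. *)
Definition coef_space (K : fieldType) (gT : finGroupType) (n : nat) (a b : gT)
    (m : nat) (rho : mx_representation K [set: gT]%G m) :
    {vspace 'cV[K]_(n + n)} :=
  <<[seq \col_x rho (dihedral_elt a b x) ij.1 ij.2 | ij : 'I_m * 'I_m]>>%VS.

Definition eigenvector_on (K : fieldType) (N : nat) (A : 'M[K]_N)
    (V : {vspace 'cV[K]_N}) (lambda : K) (v : 'cV[K]_N) : Prop :=
  [/\ v \in V, v != 0 & A *m v = lambda *: v].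

Definition eigenvalue_on (K : fieldType) (N : nat) (A : 'M[K]_N)
    (V : {vspace 'cV[K]_N}) (lambda : K) : Prop :=
  exists v, eigenvector_on A V lambda v.

Definition normalized (C : numClosedFieldType) (N : nat) (v : 'cV[C]_N) : Prop :=
  \sum_i `|v i 0| ^+ 2 = 1.

(* [lambda] is the only eigenvalue of [A] associated with [rho], and [v] is a
   normalized eigenvector for it associated with [rho]. *)
Definition associated_eigenpair (C : numClosedFieldType) (gT : finGroupType)
    (n : nat) (a b : gT) (A : 'M[C]_(n + n)) (m : nat)
    (rho : mx_representation C [set: gT]%G m)
    (lambda : C) (v : 'cV[C]_(n + n)) : Prop :=
  let V := coef_space n a b rho in
  [/\ forall mu : C, eigenvalue_on A V mu <-> mu = lambda,
      eigenvector_on A V lambda v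
    & normalized v].

Definition linear_rep_values (K : fieldType) (gT : finGroupType) (n : nat)
    (a b : gT) (psi : mx_representation K [set: gT]%G 1) (f g : nat -> K) : Prop :=
  forall k, (k < n)%N ->
    psi (a ^+ k)%g = (f k)%:M /\ psi (b * a ^+ k)%g = (g k)%:M.

(* Main.v *)
Require Import Defs.
From mathcomp Require Import all_boot all_order all_algebra.
From mathcomp Require Import all_fingroup all_solvable mxrepresentation.
From mathcomp Require Import complex reals.
Set Implicit Arguments.
Unset Strict Implicit.
Unset Printing Implicit Defensive.
Import Order.TTheory GRing.Theory Num.Theory.
Local Open Scope ring_scope.

(** Let [chi] be the scalar function underlying a one-dimensional
    representation.  Substituting [u = s^-1 x] in the neighbourhood sum
    [\sum_(u : x u^-1 in S) chi u] gives
    [(\sum_(s in S) chi s^-1) * chi x = (\sum_(s in S) chi s) * chi x], because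
    [S] is stable under inversion.  Hence [chi], read as a vector indexed by the
    group, is an eigenvector of the Cayley graph for the eigenvalue
    [\sum_(s in S) chi s] ([cayley_adjmx_character]).  The coefficient space of
    such a representation is the line through [chi], so there is no other
    associated eigenvalue; and [chi] takes its values among roots of unity, so
    its squared norm is the order of the group ([character_eigenpair]).

    What is particular to the dihedral group is the evaluation of that
    eigenvalue.  Since the group has [2n] elements, the words [a^k] and [b a^k]
    with [k < n] list each of them once ([dihedral_elt_bij]), so a sum over [S]
    splits into a sum over its rotations and a sum over its reflections, the
    latter being indexed by [b S] since [b] is an involution ([sum_rot_refl]).
    For characters with values [1] and [-1] the two sums are counts, or
    differences of counts according to the parity of [k]. *)

(** * Enumerating the dihedral group *)

Section Enumeration.

Variables (gT : finGroupType) (n : nat) (a b : gT).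
Hypothesis n_gt0 : (0 < n)%N.
Hypothesis hab : dihedral_generators n a b.
Hypothesis oG : #|gT| = (n + n)%N.

Lemma dihedral_elt_lshift (k : 'I_n) :
  dihedral_elt a b (lshift n k) = (a ^+ k)%g.
Proof. by rewrite /dihedral_elt -[lshift n k]/(unsplit (inl k)) unsplitK. Qed.

Lemma dihedral_elt_rshift (k : 'I_n) :
  dihedral_elt a b (rshift n k) = (b * a ^+ k)%g.
Proof. by rewrite /dihedral_elt -[rshift n k]/(unsplit (inr k)) unsplitK. Qed.

Lemma mem_rotations (g : gT) :
  g \in <[a]>%g -> exists k : 'I_n, g = (a ^+ k)%g.
Proof.
case: hab => an1 _ _ _ /cyclePmin[k lt_k ->].
have le_n : (#[a]%g <= n)%N by rewrite dvdn_leq // order_dvdn an1.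
by exists (Ordinal (leq_trans lt_k le_n)).
Qed.

(** Conjugation by [b] inverts [a], so the rotations form a subgroup normalised
    by [b] and every element can be written as a power of [b], with exponent
    [0] or [1], times a rotation. *)
Lemma dihedral_elt_surj (g : gT) :
  exists x : 'I_(n + n), g = dihedral_elt a b x.
Proof.
case: (hab) => an1 b2 bab genG.
have bV : (b^-1 = b)%g by apply/eqP; rewrite eq_invg_mul -expg2 b2.
have nab : (<[b]> \subset 'N(<[a]>))%g.
  rewrite cycle_subG; apply/normP; rewrite -cycleJ conjgE bV mulgA bab.
  by rewrite cycleV.
have : g \in (<[b]> * <[a]>)%g.
  rewrite -norm_joinEl // joing_idl joing_idr joingC.
  by have -> : ([set a] <*> [set b])%g = setT := genG; rewrite in_setT.
case/mulsgP=> _ _ /cyclePmin[j lt_j ->] /mem_rotations[k ->] ->.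
have le_j : (#[b]%g <= 2)%N by rewrite dvdn_leq // order_dvdn b2.
case: j {lt_j}(leq_trans lt_j le_j) => [|[|//]] _.
  by exists (lshift n k); rewrite dihedral_elt_lshift expg0 mul1g.
by exists (rshift n k); rewrite dihedral_elt_rshift expg1.
Qed.

Lemma dihedral_elt_inj : injective (@dihedral_elt gT n a b).
Proof.
suff /image_injP inj : #|codom (@dihedral_elt gT n a b)| == #|'I_(n + n)|.
  by move=> x y; apply: inj.
have -> : #|'I_(n + n)| = #|gT| by rewrite card_ord oG.
apply/eqP/eq_card => g; rewrite [RHS]inE.
by have [x ->] := dihedral_elt_surj g; apply: codom_f.
Qed.

Lemma dihedral_elt_bij : bijective (@dihedral_elt gT n a b).
Proof. by apply: inj_card_bij dihedral_elt_inj _; rewrite card_ord oG. Qed.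

Lemma reflection_notin_rotations (k : nat) :
  (k < n)%N -> (b * a ^+ k)%g \notin <[a]>%g.
Proof.
move=> lt_k; apply/negP => /mem_rotations[j].
rewrite -dihedral_elt_lshift -(dihedral_elt_rshift (Ordinal lt_k)).
by move/dihedral_elt_inj/eqP; rewrite eq_rlshift.
Qed.

Section Sums.

Variables (V : nmodType) (F : gT -> V).

Lemma sum_dihedral (T : {set gT}) :
  \sum_(g in T) F g = \sum_(k < n | (a ^+ k)%g \in T) F (a ^+ k)%g
                    + \sum_(k < n | (b * a ^+ k)%g \in T) F (b * a ^+ k)%g.
Proof.
rewrite (reindex (@dihedral_elt gT n a b)); last first.
  exact/onW_bij/dihedral_elt_bij.
rewrite big_split_ord; congr (_ + _); apply: eq_big => k;
  by rewrite ?dihedral_elt_lshift ?dihedral_elt_rshift.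
Qed.

Lemma sum_rotations (T : {set gT}) : T \subset <[a]>%g ->
  \sum_(g in T) F g = \sum_(k < n | (a ^+ k)%g \in T) F (a ^+ k)%g.
Proof.
move=> sTa; rewrite sum_dihedral [X in _ + X]big_pred0 ?addr0 // => k.
by apply: contraNF (reflection_notin_rotations (ltn_ord k)); apply: subsetP.
Qed.

(** As [b] is an involution, [b a^k] lies in [S] exactly when [a^k] lies in
    [b S]: this is why the reflections in [S] are counted by [refl_part]. *)
Lemma sum_rot_refl (S : {set gT}) :
  \sum_(g in S) F g =
    \sum_(k < n | (a ^+ k)%g \in rot_part a S) F (a ^+ k)%g
  + \sum_(k < n | (a ^+ k)%g \in refl_part a b S) F (b * a ^+ k)%g.
Proof.
case: (hab) => _ b2 _ _.
have bV : (b^-1 = b)%g by apply/eqP; rewrite eq_invg_mul -expg2 b2.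
rewrite sum_dihedral; congr (_ + _); apply: eq_bigl => k.
  by rewrite inE mem_cycle andbT.
by rewrite inE mem_cycle andbT mem_lcoset bV.
Qed.

End Sums.

Lemma card_rotations (K : pzRingType) (T : {set gT}) : T \subset <[a]>%g ->
  \sum_(k < n | (a ^+ k)%g \in T) 1 = #|T|%:R :> K.
Proof. by move=> sTa; rewrite -(sum_rotations (fun=> 1)) // sumr_const. Qed.

(** Membership in [parity_part] only asks for some exponent below [n] of the
    right parity; it is a condition on [k] itself because exponents below [n]
    are unique. *)
Lemma mem_parity_part (p : bool) (T : {set gT}) (k : 'I_n) :
  ((a ^+ k)%g \in parity_part n a p T) = ((a ^+ k)%g \in T) && (odd k == p).
Proof.
rewrite inE; congr (_ && _); apply/existsP/idP => [[j]|odd_k]; last first.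
  by exists k; rewrite eqxx.
rewrite -!dihedral_elt_lshift => /andP[/eqP/dihedral_elt_inj/eqP].
by rewrite eq_lshift => /eqP->.
Qed.

Lemma signed_card_rotations (K : pzRingType) (T : {set gT}) :
    T \subset <[a]>%g ->
  \sum_(k < n | (a ^+ k)%g \in T) (-1) ^+ k
    = #|parity_part n a false T|%:R - #|parity_part n a true T|%:R :> K.
Proof.
move=> sTa.
have sPa p : parity_part n a p T \subset <[a]>%g.
  by apply: subset_trans sTa; apply/subsetP=> g; rewrite inE => /andP[].
rewrite -!card_rotations // (bigID (fun k : 'I_n => odd k)) addrC /= -sumrN.
congr (_ + _); apply: eq_big => k; rewrite ?mem_parity_part ?eqbF_neg ?eqb_id //.
  by case/andP=> _ odd_k; rewrite -signr_odd odd_k.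
by case/andP=> _ /negPf even_k; rewrite -signr_odd even_k.
Qed.

End Enumeration.

(** * Degree-one representations as eigenvectors *)

Section Character.

Variables (C : numClosedFieldType) (gT : finGroupType).
Variable psi : mx_representation C [set: gT]%G 1.

Definition scalar_of_repr (g : gT) : C := psi g 0 0.

Local Notation chi := scalar_of_repr.

Lemma scalar_of_reprM : {morph chi : g h / (g * h)%g >-> g * h}.
Proof.
by move=> g h; rewrite /chi repr_mxM ?inE // mxE big_ord_recl big_ord0 addr0.
Qed.

Lemma scalar_of_repr1 : chi 1%g = 1.
Proof. by rewrite /chi repr_mx1 mxE. Qed.

(** By Lagrange, [chi g] is a root of unity. *)
Lemma norm_scalar_of_repr (g : gT) : `|chi g| = 1.
Proof.
have chiX k : chi (g ^+ k)%g = chi g ^+ k.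
  elim: k => [|k IHk]; first by rewrite expg0 scalar_of_repr1.
  by rewrite expgS exprS scalar_of_reprM IHk.
apply/eqP; rewrite -(pexpr_eq1 (order_gt0 g)) //.
by rewrite -normrX -chiX expg_order scalar_of_repr1 normr1.
Qed.

Variables (n : nat) (a b : gT).
Hypothesis n_gt0 : (0 < n)%N.
Hypothesis elt_bij : bijective (@dihedral_elt gT n a b).

Definition character_vec : 'cV[C]_(n + n) := \col_x chi (dihedral_elt a b x).

Lemma coef_space_degree1 : coef_space n a b psi = <[character_vec]>%VS.
Proof.
rewrite -span_seq1 /coef_space; apply/eq_span => v.
rewrite inE; apply/imageP/eqP => [[[i j] _ ->]|->].
  by apply/colP => x; rewrite !mxE /= (ord1 i) (ord1 j).
by exists (0, 0).
Qed.

Lemma character_vec_neq0 : character_vec != 0.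
Proof.
apply/eqP => /colP/(_ (lshift n (Ordinal n_gt0))); rewrite !mxE => chi0.
by have /eqP := norm_scalar_of_repr (dihedral_elt a b (lshift n (Ordinal n_gt0)));
  rewrite chi0 normr0 eq_sym oner_eq0.
Qed.

Lemma cayley_adjmx_character (S : {set gT}) : S = (S^-1)%g ->
  cayley_adjmx C n a b S *m character_vec
    = (\sum_(s in S) chi s) *: character_vec.
Proof.
move=> SV; apply/colP => x; rewrite !mxE.
set g := dihedral_elt a b x.
pose E u := (g * u^-1 \in S)%g%:R * chi u : C.
transitivity (\sum_(y : 'I_(n + n)) E (dihedral_elt a b y)).
  by apply: eq_bigr => y _; rewrite !mxE.
rewrite -(reindex (@dihedral_elt gT n a b) (F := E) (P := xpredT)) /=; last first.
  exact: onW_bij.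
(* The substitution u = s g gives g u^-1 = s^-1, and S is its own inverse. *)
rewrite (reindex_inj (mulIg g)) mulr_suml [RHS]big_mkcond /=.
apply: eq_bigr => s _; rewrite /E invMg mulKVg -scalar_of_reprM.
by rewrite -[in LHS]mem_invg -SV; case: (s \in S); rewrite ?mul1r ?mul0r.
Qed.

Lemma character_eigenpair (S : {set gT}) : S = (S^-1)%g ->
  associated_eigenpair a b (cayley_adjmx C n a b S) psi
    (\sum_(s in S) chi s) ((1 / sqrtC (2 * n)%:R) *: character_vec).
Proof.
move=> SV; set A := cayley_adjmx _ _ _ _ _; set c := 1 / _.
have n2_neq0 : (2 * n)%:R != 0 :> C by rewrite pnatr_eq0 muln_eq0 -lt0n n_gt0.
have c_neq0 : c != 0 by rewrite /c div1r invr_eq0 sqrtC_eq0.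
have eigA k : A *m (k *: character_vec)
    = (\sum_(s in S) chi s) *: (k *: character_vec).
  by rewrite -scalemxAr cayley_adjmx_character // !scalerA mulrC.
have eig : eigenvector_on A (coef_space n a b psi) (\sum_(s in S) chi s)
             (c *: character_vec).
  split; last exact: eigA.
    by rewrite coef_space_degree1 memvZ // memv_line.
  by rewrite scaler_eq0 negb_or c_neq0 character_vec_neq0.
split=> //; last first.
  rewrite /normalized (eq_bigr (fun=> (2 * n)%:R^-1)); last first.
    move=> x _; rewrite !mxE normrM norm_scalar_of_repr mulr1 /c div1r.
    by rewrite normfV ger0_norm ?sqrtC_ge0 ?ler0n // exprVn sqrtCK.
  by rewrite sumr_const card_ord addnn -mul2n -[LHS]mulr_natr mulVf.
move=> mu; split=> [[v []]|->]; last by exists (c *: character_vec).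
rewrite coef_space_degree1 => /vlineP[k ->] kv_neq0.
rewrite eigA => /eqP; rewrite eq_sym -subr_eq0 -scalerBl scaler_eq0.
by rewrite (negPf kv_neq0) orbF subr_eq0 => /eqP.
Qed.

End Character.

(** * The linear characters of the dihedral group *)

(** It is enough to know the values of the representation on [a^k] and [b a^k]
    with [k < n], both for the vector and for the eigenvalue. *)
Lemma linear_rep_eigenpair (C : numClosedFieldType) (gT : finGroupType)
    (n : nat) (a b : gT) (S : {set gT})
    (psi : mx_representation C [set: gT]%G 1) (f g : nat -> C)
    (lambda : C) (v : 'rV[C]_(n + n)) :
  (0 < n)%N -> dihedral_generators n a b -> #|gT| = (n + n)%N ->
  S = (S^-1)%g -> linear_rep_values n a b psi f g ->
  \sum_(k < n | (a ^+ k)%g \in rot_part a S) f k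
    + \sum_(k < n | (a ^+ k)%g \in refl_part a b S) g k = lambda ->
  v = row_mx (\row_(k < n) f k) (\row_(k < n) g k) ->
  associated_eigenpair a b (cayley_adjmx C n a b S) psi lambda
    ((1 / sqrtC (2 * n)%:R) *: v^T).
Proof.
move=> n_gt0 hab oG SV psiE <- ->.
have chi_rot (k : 'I_n) : scalar_of_repr psi (a ^+ k)%g = f k.
  by rewrite /scalar_of_repr (psiE k _).1 // mxE eqxx mulr1n.
have chi_refl (k : 'I_n) : scalar_of_repr psi (b * a ^+ k)%g = g k.
  by rewrite /scalar_of_repr (psiE k _).2 // mxE eqxx mulr1n.
have := character_eigenpair psi n_gt0 (dihedral_elt_bij n_gt0 hab oG) SV.
rewrite (sum_rot_refl n_gt0 hab oG).
rewrite (eq_bigr _ (fun k _ => chi_rot k)) (eq_bigr _ (fun k _ => chi_refl k)).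
congr (associated_eigenpair _ _ _ _ _ (_ *: _)).
apply/colP => x; rewrite [LHS]mxE [RHS]mxE.
case: (split_ordP x) => k ->.
  by rewrite row_mxEl mxE dihedral_elt_lshift chi_rot.
by rewrite row_mxEr mxE dihedral_elt_rshift chi_refl.
Qed.

Theorem theorem3p5 (R : realType) (n : nat) (hn : (2 <= n)%N) (hn_even : ~~ odd n)
    (a b : 'D_(2 * n)) (hab : dihedral_generators n a b)
    (S : {set 'D_(2 * n)}) (hS0 : S != set0) (hS1 : 1%g \notin S)
    (hSV : S = (S^-1)%g)
    (psi1 psi2 psi3 psi4 : mx_representation R[i] [set: 'D_(2 * n)]%G 1)
    (hpsi1 : linear_rep_values n a b psi1 (fun=> 1) (fun=> 1))
    (hpsi2 : linear_rep_values n a b psi2 (fun=> 1) (fun=> -1))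
    (hpsi3 : linear_rep_values n a b psi3
               (fun k => (-1) ^+ k) (fun k => (-1) ^+ k))
    (hpsi4 : linear_rep_values n a b psi4
               (fun k => (-1) ^+ k) (fun k => (-1) ^+ k.+1)) :
  let A : 'M[R[i]]_(n + n) := cayley_adjmx R[i] n a b S in
  let S1 := rot_part a S in
  let S2 := refl_part a b S in
  let d : R[i] := #|S|%:R in
  let s1 : R[i] := #|S1|%:R in
  let s2 : R[i] := #|S2|%:R in
  let d10 : R[i] := #|parity_part n a false S1|%:R in
  let d11 : R[i] := #|parity_part n a true S1|%:R in
  let d20 : R[i] := #|parity_part n a false S2|%:R in
  let d21 : R[i] := #|parity_part n a true S2|%:R in
  let c : R[i] := 1 / sqrtC (2 * n)%:R in
  let v1 : 'cV[R[i]]_(n + n) := c *: (const_mx 1 : 'rV[R[i]]_(n + n))^T in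
  let v2 : 'cV[R[i]]_(n + n) :=
    c *: (row_mx (const_mx 1 : 'rV[R[i]]_n) (- const_mx 1 : 'rV[R[i]]_n))^T in
  let v3 : 'cV[R[i]]_(n + n) :=
    c *: (row_mx (\row_(k < n) (-1) ^+ k) (\row_(k < n) (-1) ^+ k))^T in
  let v4 : 'cV[R[i]]_(n + n) :=
    c *: (row_mx (\row_(k < n) (-1) ^+ k) (\row_(k < n) (-1) ^+ k.+1))^T in
  [/\ associated_eigenpair a b A psi1 d v1,
      associated_eigenpair a b A psi2 (s1 - s2) v2,
      associated_eigenpair a b A psi3 (d10 - d11 + d20 - d21) v3
    & associated_eigenpair a b A psi4 (d10 - d11 + d21 - d20) v4].
Proof.
move=> A S1 S2 d s1 s2 d10 d11 d20 d21 c v1 v2 v3 v4.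
have n_gt0 : (0 < n)%N by apply: ltnW.
have oG : #|{: 'D_(2 * n)}| = (n + n)%N.
  by rewrite -cardsT mul2n card_dihedral // addnn.
have sS1a : S1 \subset <[a]>%g by apply: subsetIr.
have sS2a : S2 \subset <[a]>%g by apply: subsetIr.
have count1 := card_rotations n_gt0 hab oG R[i] sS1a.
have count2 := card_rotations n_gt0 hab oG R[i] sS2a.
have signed1 := signed_card_rotations n_gt0 hab oG R[i] sS1a.
have signed2 := signed_card_rotations n_gt0 hab oG R[i] sS2a.
split.
- apply: (linear_rep_eigenpair n_gt0 hab oG hSV hpsi1).
    by rewrite -(sum_rot_refl n_gt0 hab oG (fun=> 1)) sumr_const.
  by apply/rowP => x; rewrite mxE; case: (split_ordP x) => k ->;
    rewrite ?row_mxEl ?row_mxEr mxE.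
- apply: (linear_rep_eigenpair n_gt0 hab oG hSV hpsi2).
    by rewrite sumrN count1 count2.
  by congr row_mx; apply/rowP => k; rewrite !mxE.
- apply: (linear_rep_eigenpair n_gt0 hab oG hSV hpsi3) => //.
  by rewrite signed1 signed2 addrA.
apply: (linear_rep_eigenpair n_gt0 hab oG hSV hpsi4) => //.
under [X in _ + X]eq_bigr => k _ do rewrite exprS mulN1r.
by rewrite sumrN signed1 signed2 opprB addrA.
Qed.
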